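(* Let $(X,\odot,{}^*,1)$ be a (left-)quantum-MV algebra satisfying, for all $x,y\in X$, $$x\wedge_m^M (x\vee_m^M y)=x\quad\text{and}\quad (y^*\vee_m^M x)\odot y=x\odot y.$$ Then $X$ is an MV algebra.
   Context: An involutive left-m-BE algebra is an algebra $(X,\odot,{}^*,1)$ of type $(2,1,0)$ such that, with $0:=1^*$, for all $x,y,z\in X$: $1\odot x=x=x\odot 1$; $x\odot y=y\odot x$; $x\odot(y\odot z)=(x\odot y)\odot z$; $x\odot 0=0$; $x\odot x^*=0$; $x^{**}=x$. In it put $x\wedge_m^M y:=(x^*\odot y)^*\odot y$ and $x\vee_m^M y:=(x^*\wedge_m^M y^* )^*$. A (left-)quantum-MV algebra is an involutive left-m-BE algebra satisfying $x\odot((x^*\vee_m^M y)\vee_m^M(z\vee_m^M x^* ))=(x\odot y)\vee_m^M(x\odot z)$ for all $x,y,z\in X$. A (left-)MV algebra is an involutive left-m-BE algebra satisfying $(x^*\odot y)^*\odot y=(y^*\odot x)^*\odot x$ for all $x,y\in X$. *)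

(* Defs.v *)
Declare Scope mbe_scope.
Delimit Scope mbe_scope with mbe.

(* Algebras of type (2,1,0). *)
Record algebra := Algebra {
  carrier :> Type;
  odot : carrier -> carrier -> carrier;
  neg : carrier -> carrier;
  one : carrier
}.

Arguments odot {X} _ _ : rename.
Arguments neg {X} _ : rename.
Arguments one {X} : rename.

Notation "x ⊙ y" := (odot x y) (at level 40, left associativity) : mbe_scope.
Notation "x ^*" := (neg x) (at level 2, left associativity, format "x ^*")
  : mbe_scope.
Notation "1" := one : mbe_scope.
Local Open Scope mbe_scope.

Definition zero {X : algebra} : X := 1^*.
Notation "0" := zero : mbe_scope.

(* Neither operation is commutative in general. *)
Definition meetM {X : algebra} (x y : X) : X := (x^* ⊙ y)^* ⊙ y.
Notation "x ∧m y" := (meetM x y) (at level 50, no associativity) : mbe_scope.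

Definition joinM {X : algebra} (x y : X) : X := (x^* ∧m y^*)^*.
Notation "x ∨m y" := (joinM x y) (at level 50, no associativity) : mbe_scope.

Record involutive_left_mBE (X : algebra) : Prop := InvolutiveLeftMBE {
  odot1x : forall x : X, 1 ⊙ x = x;
  odotx1 : forall x : X, x ⊙ 1 = x;
  odotC : forall x y : X, x ⊙ y = y ⊙ x;
  odotA : forall x y z : X, x ⊙ (y ⊙ z) = (x ⊙ y) ⊙ z;
  odotx0 : forall x : X, x ⊙ 0 = 0;
  odotxN : forall x : X, x ⊙ x^* = 0;
  negK : forall x : X, x^*^* = x
}.

Record quantum_MV (X : algebra) : Prop := QuantumMV {
  quantum_MV_mBE : involutive_left_mBE X;
  quantum_MV_law : forall x y z : X,
    x ⊙ ((x^* ∨m y) ∨m (z ∨m x^*)) = (x ⊙ y) ∨m (x ⊙ z)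
}.

Record MV (X : algebra) : Prop := MValgebra {
  MV_mBE : involutive_left_mBE X;
  MV_law : forall x y : X, (x^* ⊙ y)^* ⊙ y = (y^* ⊙ x)^* ⊙ x
}.

(* Main.v *)
From Stdlib Require Import Setoid.
Require Import Defs.
Local Open Scope mbe_scope.

(** Write [a ≤ b] when [a] is a multiple of [b].  Two special cases of the
    quantum-MV law, [x ∨m (x ⊙ z) = x] and [(x ⊙ z) ∨m x = x], make [≤] an order
    that is reversed by negation; multiplication by a fixed element preserves it.
    Since [x ∨m y] is obtained from [x] by two such multiplications and two
    negations, it is monotone in [x].  Always [y ≤ x ∨m y], and absorption gives
    [x ≤ x ∨m y =: w], so [y ∨m x ≤ w ∨m x = w]; by symmetry and antisymmetry
    [∨m] is commutative, which is the MV law up to negation. *)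

Definition le {X : algebra} (a b : X) : Prop := exists c : X, a = b ⊙ c.

Section QuantumMV.

Context {X : algebra} (hX : quantum_MV X).
Let hB : involutive_left_mBE X := quantum_MV_mBE X hX.

Lemma joinE (x y : X) : x ∨m y = ((x ⊙ y^*)^* ⊙ y^*)^*.
Proof. unfold joinM, meetM. now rewrite (negK X hB x). Qed.

Lemma joinx1 (x : X) : x ∨m 1 = 1.
Proof.
  rewrite joinE. fold (@zero X). rewrite (odotx0 X hB).
  apply (negK X hB).
Qed.

Lemma join1x (x : X) : 1 ∨m x = 1.
Proof.
  rewrite joinE, (odot1x X hB), (negK X hB), (odotxN X hB).
  apply (negK X hB).
Qed.

(** Setting [y] to [1] in the quantum-MV law collapses the bracket on its left to [1]. *)
Lemma join_odotr (x z : X) : x ∨m (x ⊙ z) = x.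
Proof.
  pose proof (quantum_MV_law X hX x 1 z) as H.
  now rewrite joinx1, join1x, (odotx1 X hB) in H.
Qed.

Lemma join_odotl (x y : X) : (x ⊙ y) ∨m x = x.
Proof.
  pose proof (quantum_MV_law X hX x y 1) as H.
  now rewrite join1x, joinx1, (odotx1 X hB) in H.
Qed.

Lemma le_join (a b : X) : le a b -> b ∨m a = b.
Proof. intros [c ->]. apply join_odotr. Qed.

Lemma le_antisym (a b : X) : le a b -> le b a -> a = b.
Proof.
  intros [c Hc] Hba. rewrite <- (le_join b a Hba), Hc. apply join_odotl.
Qed.

Lemma le_neg (a b : X) : le a b -> le b^* a^*.
Proof.
  intros H. exists (b ⊙ a^*)^*.
  rewrite <- (le_join a b H) at 1.
  rewrite joinE, (negK X hB). apply (odotC X hB).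
Qed.

Lemma le_odot2r (a b z : X) : le a b -> le (a ⊙ z) (b ⊙ z).
Proof.
  intros [c ->]. exists c.
  now rewrite <- !(odotA X hB), (odotC X hB c z).
Qed.

Lemma le_join2r (a b z : X) : le a b -> le (a ∨m z) (b ∨m z).
Proof.
  intros H. rewrite !joinE.
  now apply le_neg, le_odot2r, le_neg, le_odot2r.
Qed.

Lemma le_joinr (x y : X) : le y (x ∨m y).
Proof.
  rewrite joinE, <- (negK X hB y) at 1. apply le_neg.
  exists (x ⊙ y^*)^*. apply (odotC X hB).
Qed.

Lemma joinC_of_absorption (habs : forall x y : X, x ∧m (x ∨m y) = x) (x y : X) :
  x ∨m y = y ∨m x.
Proof.
  assert (H : forall u v : X, le (v ∨m u) (u ∨m v)).
  { intros u v.
    assert (Hu : le u (u ∨m v)).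
    (* With [w := u ∨m v], absorption unfolds to [u = (u^* ⊙ w)^* ⊙ w], a multiple of [w]. *)
    { exists (u^* ⊙ (u ∨m v))^*.
      rewrite <- (habs u v) at 1. apply (odotC X hB). }
    rewrite <- (le_join _ _ Hu). apply le_join2r, le_joinr. }
  now apply le_antisym.
Qed.

End QuantumMV.

Theorem theorem5p14 (X : algebra) (hX : quantum_MV X)
    (habs : forall x y : X, x ∧m (x ∨m y) = x)
    (hprod : forall x y : X, (y^* ∨m x) ⊙ y = x ⊙ y) :
  MV X.
Proof.
  pose proof (quantum_MV_mBE X hX) as hB.
  split; [exact hB|intros x y].
  (* At negated arguments both joins are the negations of the two sides of the MV law. *)
  pose proof (joinC_of_absorption hX habs x^* y^*) as H.
  rewrite !(joinE hX), !(negK X hB) in H.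
  now rewrite <- (negK X hB ((x^* ⊙ y)^* ⊙ y)), H, (negK X hB).
Qed.
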